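(* For every $c>0$ there exists $\epsilon>0$ such that the following holds. Let $n\ge 1$ and let $\sigma\in\{0,1\}^n$ be written as $\sigma=\sigma_1\sigma_2\cdots\sigma_m$, where each $\sigma_i$ is either $0^{L_i}$ or $1^{L_i}$, each $L_i$ is chosen maximal (so $\sigma_1,\dots,\sigma_m$ are the maximal runs of equal bits of $\sigma$), and $m\ge cn$. Let $\alpha\in\mathbb{Z}_{2^n-1}$ have base-$2$ representation $\sigma$. Then $\alpha$ has the $\epsilon$-shifting property, i.e. $\left|M\cup(\alpha+M)\right|\ge\left(\tfrac12+\epsilon\right)2^n$.
   Context: Elements of $\mathbb{Z}_{2^n-1}$ are identified with $n$-bit binary strings via their base-$2$ representations (most significant bit first). For a bit string $x$, $wt(x)$ denotes its Hamming weight. $M=\{x : wt(x)\le \frac n2\}$ is the set of ''light'' strings, and $\alpha+M=\{\alpha+x : x\in M\}$ with addition in $\mathbb{Z}_{2^n-1}$. An element $\alpha$ is said to have the $\epsilon$-shifting property if $|M\cup(\alpha+M)|\ge(\frac12+\epsilon)2^n$.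
   Formalization: The union M ∪ (α+M) is counted as a set of n-bit strings, where both 0^n and 1^n represent 0, so 1^n is counted when 0 ∈ α+M; counting residues would make the claim false for n=1 (and for odd n ≤ 1/c with α=0). *)

(* Defs.v *)
From HB Require Import structures.
From mathcomp Require Import all_boot all_order all_algebra.
From mathcomp Require Import reals.

Set Implicit Arguments.
Unset Strict Implicit.
Unset Printing Implicit Defensive.

Import Order.TTheory GRing.Theory Num.Theory.

(* Z_{2^n-1}, with the additive group structure that zmodp.v puts on 'I_p.+1.
   The modulus (2 ^ n - 2).+1 equals 2 ^ n - 1 for every n >= 1, including
   n = 1 (the trivial group), where 'Z_(2 ^ n - 1) would be Z/2. *)
Notation Zmers n := ('I_(2 ^ n - 2).+1).

Definition bits_val (s : seq bool) : nat :=
  foldl (fun v (b : bool) => v.*2 + b) 0 s.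

(* The identification of n-bit strings with elements of Z_{2^n-1}. It is
   injective except that 0^n and 1^n both represent 0. *)
Definition residue n (x : n.-tuple bool) : Zmers n := inZp (bits_val x).

Definition wt (s : seq bool) : nat := count id s.

Definition light n : {set n.-tuple bool} := [set x : n.-tuple bool | (wt x).*2 <= n].

(* alpha + A, as the set of all n-bit strings representing some alpha + x. *)
Definition shift n (alpha : Zmers n) (A : {set n.-tuple bool}) :
    {set n.-tuple bool} :=
  @residue n @^-1: [set (alpha + residue x)%R | x in A].

Definition shifting_property (R : realType) (eps : R) n (alpha : Zmers n) : Prop :=
  ((2^-1 + eps) * 2 ^+ n <= #|light n :|: shift alpha (light n)|%:R)%R.

(* r = [:: (b_1, L_1); ...; (b_m, L_m)] encodes s = b_1^{L_1} ... b_m^{L_m}.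
   The L_i are maximal exactly when neighbouring blocks carry different bits. *)
Definition maximal_runs (s : seq bool) (r : seq (bool * nat)) : Prop :=
  [/\ s = flatten [seq nseq p.2 p.1 | p <- r],
      all (fun p => 0 < p.2) r
    & sorted (fun p q => p.1 != q.1) r].

(* Main.v *)
(* Addition of [alpha] is realised by a bijection [T] of bit strings (binary
   addition with end-around carry), and it suffices that a positive fraction of
   the light strings [x] have [T x] heavy.
   At a position [i] with [sigma_i <> sigma_(i+1)], if [x_(i+1) = sigma_(i+1)]
   then the carry into position [i] is [sigma_(i+1)], so [(T x)_i = ~~ x_i]; if
   moreover [x_(i-1) <> x_i], exchanging these two bits fixes the weight of [x]
   and changes [T x] in position [i] only.  Let [s_i = 0, 1, -1] be the
   resulting decrease of the weight of [T x].  Choosing the positions [i] in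
   one class modulo 3 makes the exchanges independent.
   Tilt the uniform measure by the density [prod_i (1 + theta s_i)] with
   [theta] of order [n^(-1/2)].  The law of the weight of [x] is unchanged, so
   [x] is light with probability at least 1/2, whereas the weight of [T x]
   acquires a drift of order [theta n], several standard deviations; hence
   [x] light and [T x] heavy has tilted probability at least 1/4.  The density
   is bounded in [L^2], so the uniform probability is bounded below as well. *)
Require Import Defs.
From HB Require Import structures.
From mathcomp Require Import all_boot all_order all_algebra.
From mathcomp Require Import ring lra zify.
From mathcomp Require Import reals.

Set Implicit Arguments.
Unset Strict Implicit.
Unset Printing Implicit Defensive.

Import Order.TTheory GRing.Theory Num.Theory.
Local Open Scope ring_scope.

(** * Finite sums under involutions, and orthogonality *)

Lemma sum_involutive (R : nmodType) (X : finType) (f : X -> X) (F : X -> R) :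
  involutive f -> \sum_x F (f x) = \sum_x F x.
Proof.
by move=> fK; rewrite [RHS](reindex_inj (inv_inj fK)).
Qed.

Lemma sum_odd_involutive (R : realFieldType) (X : finType) (f : X -> X)
    (F : X -> R) :
  involutive f -> (forall x, F (f x) = - F x) -> \sum_x F x = 0.
Proof.
move=> fK Fodd; have := sum_involutive F fK.
under eq_bigr do rewrite Fodd.
rewrite sumrN => H; lra.
Qed.

Lemma sum_weighted_sqr_orthogonal (R : comPzRingType) (X : finType)
    (I : eqType) (r : seq I) (w : X -> R) (f : I -> X -> R) :
  uniq r ->
  {in r &, forall i j, i != j -> \sum_x w x * (f i x * f j x) = 0} ->
  \sum_x w x * (\sum_(i <- r) f i x) ^+ 2 =
  \sum_(i <- r) \sum_x w x * f i x ^+ 2.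
Proof.
move=> r_uniq orth.
under eq_bigr do rewrite expr2 mulr_suml mulr_sumr.
rewrite exchange_big /= !big_seq; apply: eq_bigr => i ir.
under eq_bigr do rewrite !mulr_sumr.
rewrite exchange_big /= (bigD1_seq i) //= [X in _ + X]big_seq_cond.
rewrite [X in _ + X]big1 ?addr0 //.
by move=> j /andP[jr ji]; apply: orth => //; rewrite eq_sym.
Qed.

(** * Second-moment method for a measure tilted along sign-reversing involutions *)

Section ExponentialTilt.

Variables (R : realFieldType) (X : finType) (I : eqType) (r : seq I).
Variables (phi : I -> X -> X) (s : I -> X -> R).
Hypothesis r_uniq : uniq r.
Hypothesis phiK : {in r, forall i, involutive (phi i)}.
Hypothesis s_anti : {in r, forall i x, s i (phi i x) = - s i x}.
Hypothesis s_inv : {in r &, forall i j x, j != i -> s j (phi i x) = s j x}.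

(** [phi i] negates [s i] and fixes [F] and all other factors, so averaging over [x] and [phi i x]
    replaces [g] by its even part. The even part is fixed by the remaining involutions and can be
    absorbed into [F], which drives the induction. *)
Lemma sum_prod_symmetrize (g : R -> R) (q : seq I) (F : X -> R) :
  uniq q -> {subset q <= r} -> {in q, forall i x, F (phi i x) = F x} ->
  \sum_x (\prod_(i <- q) g (s i x)) * F x =
  \sum_x (\prod_(i <- q) ((g (s i x) + g (- s i x)) / 2)) * F x.
Proof.
elim: q F => [|i q IH] F /=.
  by move=> _ _ _; apply: eq_bigr => x _; rewrite !big_nil.
move=> /andP[iq q_uniq] sub Finv.
have ir : i \in r by apply: sub; rewrite mem_head.
have subq : {subset q <= r} by move=> j jq; apply: sub; rewrite inE jq orbT.
have neq j : j \in q -> j != i by apply: contraTneq => ->.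
pose K x := (\prod_(j <- q) g (s j x)) * F x.
have Kinv x : K (phi i x) = K x.
  rewrite /K Finv ?mem_head //; congr (_ * _).
  by apply: eq_big_seq => j jq; rewrite (s_inv ir (subq _ jq)) ?neq.
transitivity (\sum_x ((g (s i x) + g (- s i x)) / 2) * K x).
  have E : \sum_x g (s i x) * K x = \sum_x g (- s i x) * K x.
    rewrite -(sum_involutive _ (phiK ir)); apply: eq_bigr => x _.
    by rewrite s_anti // Kinv.
  under eq_bigr do rewrite big_cons -mulrA -/(K _).
  under [RHS]eq_bigr do rewrite mulrAC mulrDl.
  by rewrite -mulr_suml big_split /= -E; field.
transitivity (\sum_x (\prod_(j <- q) g (s j x)) *
    ((g (s i x) + g (- s i x)) / 2 * F x)).
  by apply: eq_bigr => x _; rewrite mulrCA.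
rewrite IH //; last first.
  move=> j jq x; rewrite Finv ?inE ?jq ?orbT //.
  by rewrite (s_inv (subq _ jq) ir) // eq_sym neq.
by apply: eq_bigr => x _; rewrite big_cons; ring.
Qed.

Variable theta : R.

(** Linear factors stand in for exponentials of [theta * s i x]: the even part of each is exactly 1,
    so the total mass stays [#|X|]. *)
Definition tilt (x : X) : R := \prod_(i <- r) (1 + theta * s i x).

Lemma sum_tilt_invariant (F : X -> R) :
  {in r, forall i x, F (phi i x) = F x} ->
  \sum_x tilt x * F x = \sum_x F x.
Proof.
move=> Finv; rewrite (sum_prod_symmetrize (fun t => 1 + theta * t)) //.
by apply: eq_bigr => x _; rewrite big1 ?mul1r // => i _; field.
Qed.

Lemma sum_tilt : \sum_x tilt x = #|X|%:R.
Proof.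
under eq_bigr do rewrite -[tilt _]mulr1.
by rewrite sum_tilt_invariant // sumr_const.
Qed.

(** The difference of the two summands is [s i x * (1 - theta ^+ 2 * s i x ^+ 2)] times a function
    invariant under [phi i], hence odd under [phi i]. *)
Lemma sum_tilt_step i (F : X -> R) : i \in r ->
  (forall x, F (phi i x) = F x) ->
  \sum_x tilt x * (s i x * F x) = theta * \sum_x tilt x * (s i x ^+ 2 * F x).
Proof.
move=> ir Finv.
pose K x := (\prod_(j <- r | j != i) (1 + theta * s j x)) * F x.
have Kinv x : K (phi i x) = K x.
  rewrite /K Finv big_seq_cond [in RHS]big_seq_cond; congr (_ * _).
  by apply: eq_bigr => j /andP[jr ji]; rewrite s_inv.
have tiltE x : tilt x = (1 + theta * s i x) *
    \prod_(j <- r | j != i) (1 + theta * s j x).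
  by rewrite /tilt (bigD1_seq i).
apply/eqP; rewrite mulr_sumr -subr_eq0 -sumrB; apply/eqP.
apply: (sum_odd_involutive (phiK ir)) => x.
have E y : tilt y * (s i y * F y) - theta * (tilt y * (s i y ^+ 2 * F y)) =
    s i y * (1 - theta ^+ 2 * s i y ^+ 2) * K y.
  by rewrite tiltE /K; ring.
by rewrite !E Kinv s_anti //; ring.
Qed.

Hypothesis s_le1 : {in r, forall i x, `|s i x| <= 1}.
Hypothesis theta_ge0 : 0 <= theta.
Hypothesis theta_le1 : theta <= 1.

Lemma tilt_ge0 x : 0 <= tilt x.
Proof.
rewrite /tilt big_seq; apply: prodr_ge0 => i ir.
have := s_le1 ir x; rewrite ler_norml => /andP[s_ge _].
have : 0 <= theta * (s i x + 1) by rewrite mulr_ge0 //; lra.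
by move: theta_le1; lra.
Qed.

Lemma s_sqr_le1 i x : i \in r -> s i x ^+ 2 <= 1.
Proof.
by move=> ir; rewrite -real_normK ?num_real // expr_le1 ?normr_ge0 ?s_le1.
Qed.

Lemma sum_tilt_sqr_le :
  \sum_x tilt x ^+ 2 <= (1 + theta ^+ 2) ^+ size r * #|X|%:R.
Proof.
have E : \sum_x tilt x ^+ 2 =
    \sum_x (\prod_(i <- r) (1 + theta ^+ 2 * s i x ^+ 2)) * 1.
  rewrite (eq_bigr (fun x => (\prod_(i <- r) (1 + theta * s i x) ^+ 2) * 1)).
    rewrite (sum_prod_symmetrize (fun t => (1 + theta * t) ^+ 2)) //.
    by apply: eq_bigr => x _; congr (_ * _); apply: eq_bigr => i _; field.
  by move=> x _; rewrite mulr1 /tilt prodrXl.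
have -> : #|X|%:R = \sum_(x in X) (1 : R) by rewrite sumr_const.
rewrite E mulr_sumr; apply: ler_sum => x _.
rewrite ler_wpM2r //.
have -> : (1 + theta ^+ 2) ^+ size r = \prod_(i <- r) (1 + theta ^+ 2).
  by rewrite big_const_seq count_predT iter_mulr_1.
rewrite big_seq [leRHS]big_seq; apply: ler_prod => i ir.
have := s_sqr_le1 x ir; have := sqr_ge0 (s i x); have := sqr_ge0 theta.
by move=> ? ? ?; apply/andP; split; nra.
Qed.

Hypothesis s_sqr_orth : {in r &, forall i j, i != j ->
  \sum_x (s i x ^+ 2 - 4^-1) * (s j x ^+ 2 - 4^-1) = 0}.

(** In the application [4^-1] is the proportion of [x] with [s i x] nonzero, so [theta / 4] is the
    tilted mean of [s i]. Cross terms vanish: [sum_tilt_step] at [i] and then at [j] leaves centred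
    squares, which all involutions preserve, so the tilt drops out and [s_sqr_orth] applies. *)
Lemma sum_tilt_centered_sqr_le :
  \sum_x tilt x * (\sum_(i <- r) (s i x - theta / 4)) ^+ 2 <=
  2 * (size r)%:R * #|X|%:R.
Proof.
rewrite sum_weighted_sqr_orthogonal //.
  have -> : 2 * (size r)%:R * #|X|%:R = \sum_(i <- r) (2 * #|X|%:R) :> R.
    by rewrite big_const_seq count_predT iter_addr_0 -mulr_natr; ring.
  rewrite big_seq [leRHS]big_seq; apply: ler_sum => i ir.
  rewrite -sum_tilt mulr_sumr; apply: ler_sum => x _.
  rewrite mulrC ler_wpM2r ?tilt_ge0 //.
  have := s_le1 ir x; rewrite ler_norml => /andP[s_ge s_le].
  rewrite -real_normK ?num_real //.
  have : `|s i x - theta / 4| <= 5 / 4.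
    by rewrite ler_norml; apply/andP; split; move: theta_ge0 theta_le1; lra.
  have := normr_ge0 (s i x - theta / 4); nra.
have step i (F : X -> R) : i \in r -> (forall x, F (phi i x) = F x) ->
    \sum_x tilt x * ((s i x - theta / 4) * F x) =
    theta * \sum_x tilt x * ((s i x ^+ 2 - 4^-1) * F x).
  move=> ir Finv; under eq_bigr do rewrite mulrBl mulrBr.
  rewrite sumrB sum_tilt_step //.
  under [in RHS]eq_bigr do rewrite mulrBl mulrBr.
  rewrite sumrB mulrBr; congr (_ - _).
  by rewrite mulr_sumr; apply: eq_bigr => x _; ring.
move=> i j ir jr ij; rewrite step // => [|x]; last first.
  by rewrite s_inv // eq_sym.
under eq_bigr do rewrite [_ * (s j _ - _)]mulrC.
rewrite step // => [|x]; last by rewrite s_inv.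
under eq_bigr do rewrite [_ * (s i _ ^+ 2 - _)]mulrC.
rewrite sum_tilt_invariant ?s_sqr_orth ?mulr0 // => k kr x.
have inv2 l : l \in r -> s l (phi k x) ^+ 2 = s l x ^+ 2.
  move=> lr; have [->|lk] := eqVneq l k; last by rewrite s_inv.
  by rewrite s_anti // sqrrN.
by rewrite !inv2.
Qed.

Variables (h : X -> R) (v : R).
Hypothesis h_phi : {in r, forall i x, h (phi i x) = h x - s i x}.
Hypothesis h_sqr : \sum_x h x ^+ 2 <= v * #|X|%:R.

(** [h] splits into an invariant part [h0], whose second moment the tilt does not affect, and half
    the sum of the [s i], which carries the drift. *)
Lemma sum_tilt_deviation_le :
  \sum_x tilt x * (h x - theta * (size r)%:R / 8) ^+ 2 <=
  (2 * v + (size r)%:R) * #|X|%:R.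
Proof.
pose h0 x := h x - (\sum_(i <- r) s i x) / 2.
have h0_inv : {in r, forall i x, h0 (phi i x) = h0 x}.
  move=> i ir x; rewrite /h0 h_phi // (bigD1_seq i) //= s_anti //.
  rewrite [in RHS](bigD1_seq i) //= big_seq_cond [in RHS]big_seq_cond.
  rewrite (eq_bigr (fun j => s j x)); first by field.
  by move=> j /andP[jr ji]; rewrite s_inv.
have h0_sqr : \sum_x h0 x ^+ 2 <= v * #|X|%:R.
  apply: le_trans h_sqr.
  have -> : \sum_x h x ^+ 2 = \sum_x h0 x ^+ 2 +
      \sum_x (h0 x * \sum_(i <- r) s i x + (\sum_(i <- r) s i x) ^+ 2 / 4).
    by rewrite -big_split /=; apply: eq_bigr => x _; rewrite /h0; field.
  (* [h0] is orthogonal to the sum of the [s i], each product [h0 x * s i x] being odd under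
     [phi i]. *)
  rewrite lerDl big_split /= [X in X + _](_ : _ = 0) ?add0r.
    by apply: sumr_ge0 => x _; rewrite divr_ge0 ?sqr_ge0.
  under eq_bigr do rewrite mulr_sumr.
  rewrite exchange_big /= big_seq big1 // => i ir.
  apply: (sum_odd_involutive (phiK ir)) => x.
  by rewrite s_anti // h0_inv // mulrN.
have E x : h x - theta * (size r)%:R / 8 =
    h0 x + (\sum_(i <- r) (s i x - theta / 4)) / 2.
  by rewrite sumrB big_const_seq count_predT iter_addr_0 -mulr_natr /h0; field.
(* The square of a sum is at most twice the sum of the squares. *)
apply: le_trans (_ : \sum_x (tilt x * (2 * h0 x ^+ 2) + 2^-1 *
  (tilt x * (\sum_(i <- r) (s i x - theta / 4)) ^+ 2)) <= _).
  apply: ler_sum => x _; rewrite [X in _ <= _ + X]mulrCA -mulrDr.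
  rewrite ler_wpM2l ?tilt_ge0 // E; set D := \sum_(i <- r) _.
  have := sqr_ge0 (h0 x - D / 2); lra.
rewrite big_split /= sum_tilt_invariant; last first.
  by move=> i ir x; rewrite h0_inv.
rewrite -!mulr_sumr; have := sum_tilt_centered_sqr_le; lra.
Qed.

Variable heavy : pred X.
Hypothesis heavy_phi : {in r, forall i x, heavy (phi i x) = heavy x}.
Hypothesis heavy_card : 2 * #|heavy|%:R <= #|X|%:R :> R.
Hypothesis drift_large :
  4 * (2 * v + (size r)%:R) <= (theta * (size r)%:R / 8) ^+ 2.

(** Under the tilt, [heavy] has mass at most 1/2 and, by Chebyshev, the points with [h x <= 0] at
    most 1/4. The remaining 1/4 lies on the wanted set, and the second moment of the density turns
    this mass into a count. *)
Lemma card_light_positive_ge :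
  0 < theta * (size r)%:R ->
  #|X|%:R <= 16 * (1 + theta ^+ 2) ^+ size r *
    #|[pred x | ~~ heavy x & 0 < h x]|%:R :> R.
Proof.
move=> drift_gt0.
set B := [pred x | _].
pose m := theta * (size r)%:R / 8.
have drift : 4 * (2 * v + (size r)%:R) <= m ^+ 2 by [].
set C := (1 + theta ^+ 2) ^+ size r.
have C_gt0 : 0 < C by rewrite exprn_gt0 // ltr_pwDl // sqr_ge0.
have m_gt0 : 0 < m by rewrite /m; lra.
have heavy_sum : \sum_x tilt x * (heavy x)%:R <= #|X|%:R / 2.
  rewrite sum_tilt_invariant => [|i ir x]; last by rewrite heavy_phi.
  have -> : \sum_x (heavy x)%:R = #|heavy|%:R :> R.
    by rewrite -natr_sum -sum1_card [in RHS]big_mkcond.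
  by move: heavy_card; lra.
have low_sum : \sum_x tilt x * (h x <= 0)%R%:R <= #|X|%:R / 4.
  have m2_gt0 : 0 < m ^+ 2 by rewrite exprn_gt0.
  rewrite -(ler_pM2r m2_gt0).
  apply: le_trans (_ : \sum_x tilt x * (h x - m) ^+ 2 <= _).
    rewrite mulr_suml; apply: ler_sum => x _.
    rewrite -mulrA ler_wpM2l ?tilt_ge0 //.
    case: (leP (h x) 0) => hx /=; last by rewrite mulr0n mul0r sqr_ge0.
    by rewrite mulr1n mul1r; nra.
  apply: le_trans sum_tilt_deviation_le _.
  have := ler_wpM2r (ler0n R #|X|) drift; lra.
have B_sum : #|X|%:R / 4 <= \sum_x tilt x * (x \in B)%:R.
  suff : \sum_x tilt x <= \sum_x tilt x * (x \in B)%:R +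
      \sum_x tilt x * (heavy x)%:R + \sum_x tilt x * (h x <= 0)%R%:R.
    by rewrite sum_tilt; lra.
  rewrite -!big_split; apply: ler_sum => x _ /=.
  have := tilt_ge0 x; rewrite -!mulrDr inE /=.
  by case: (heavy x); case: (leP (h x) 0) => _ /=; lra.
(* Linearised Cauchy-Schwarz; [8 * C] is chosen so that the second-moment term uses up only half of
   the mass [#|X|%:R / 4]. *)
have amgm : \sum_x tilt x * (x \in B)%:R <=
    (8 * C)^-1 * \sum_x tilt x ^+ 2 + 2 * C * #|B|%:R.
  rewrite -sum1_card natr_sum !mulr_sumr big_mkcond [X in _ + X]big_mkcond /=.
  rewrite -big_split /=; apply: ler_sum => x _.
  case: ifP => _; rewrite ?mulr0 ?mulr1 ?addr0; last first.
    by rewrite mulr_ge0 ?sqr_ge0 // invr_ge0 mulr_ge0 ?ltW.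
  have : 0 <= (8 * C)^-1 * (tilt x - 4 * C) ^+ 2.
    by rewrite mulr_ge0 ?sqr_ge0 // invr_ge0 mulr_ge0 ?ltW.
  suff -> : (8 * C)^-1 * (tilt x - 4 * C) ^+ 2 =
      (8 * C)^-1 * tilt x ^+ 2 + 2 * C - tilt x by lra.
  by field; rewrite gt_eqF.
have : (8 * C)^-1 * \sum_x tilt x ^+ 2 <= #|X|%:R / 8.
  have -> : #|X|%:R / 8 = (8 * C)^-1 * (C * #|X|%:R).
    by field; rewrite gt_eqF.
  by rewrite ler_wpM2l ?sum_tilt_sqr_le // invr_ge0 mulr_ge0 ?ltW.
lra.
Qed.

End ExponentialTilt.

(** * Bit strings and their binary values *)

Lemma bits_val_rcons s b : bits_val (rcons s b) = ((bits_val s).*2 + b)%N.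
Proof. by rewrite /bits_val -cats1 foldl_cat. Qed.

Lemma bits_valE s :
  bits_val s = (\sum_(k < size s) nth false s k * 2 ^ (size s - k.+1))%N.
Proof.
elim/last_ind: s => [|s b IH]; first by rewrite big_ord0.
rewrite bits_val_rcons IH size_rcons big_ord_recr /= nth_rcons ltnn eqxx.
rewrite subnn muln1 -mul2n big_distrr /=; congr (_ + _)%N.
apply: eq_bigr => k _; rewrite nth_rcons ltn_ord mulnCA -expnS.
by rewrite subSn.
Qed.

Lemma wtE s : wt s = (\sum_(k < size s) nth false s k)%N.
Proof. by rewrite /wt -sumn_count sumnE big_map (big_nth false) big_mkord. Qed.

Lemma bits_val_nseq_true n : (bits_val (nseq n true)).+1 = (2 ^ n)%N.
Proof.
elim: n => // n IH.
rewrite -[in LHS](addn1 n) nseqD cats1 bits_val_rcons expnS -IH -mul2n; lia.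
Qed.

Lemma ltn_bits_val s : (bits_val s < 2 ^ size s)%N.
Proof.
elim/last_ind: s => // s b IH; rewrite bits_val_rcons size_rcons expnS.
by case: b; lia.
Qed.

Lemma nth_bits_val s i : (i < size s)%N ->
  nth false s i = odd (bits_val s %/ 2 ^ (size s - i.+1)).
Proof.
elim/last_ind: s i => // s b IH i.
rewrite size_rcons ltnS leq_eqVlt nth_rcons bits_val_rcons => /predU1P[->|lt_i].
  by rewrite ltnn eqxx subnn divn1 oddD odd_double oddb.
rewrite lt_i IH // subSn // expnS divnMA -muln2 divnMDl //.
by rewrite (divn_small (_ : b < 2)%N) ?addn0 //; case: b.
Qed.

Lemma eq_from_nth_tuple n (x y : n.-tuple bool) :
  (forall i, (i < n)%N -> nth false x i = nth false y i) -> x = y.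
Proof. by move=> E; apply: eq_from_tnth => i; rewrite !(tnth_nth false) E. Qed.

Lemma bits_val_inj n : injective (fun x : n.-tuple bool => bits_val x).
Proof.
move=> x y /= E; apply: eq_from_nth_tuple => i lt_i.
by rewrite !nth_bits_val ?size_tuple // E.
Qed.

Definition bits_of n v : n.-tuple bool :=
  [tuple odd (v %/ 2 ^ (n - k.+1)) | k < n].

Lemma bits_ofK n v : (v < 2 ^ n)%N -> bits_val (bits_of n v) = v.
Proof.
(* The induction on [n] needs arbitrary [v]: the last [n] bits represent [v] modulo [2 ^ n]. *)
suff E : bits_val (mkseq (fun k => odd (v %/ 2 ^ (n - k.+1))) n) =
         (v %% 2 ^ n)%N.
  move=> lt_v; rewrite -[RHS](modn_small lt_v) -E; congr bits_val.
  by rewrite /mkseq -val_enum_ord -map_comp.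
elim: n v => [|n IH] v; first by rewrite modn1.
rewrite mkseqS bits_val_rcons subnn divn1.
have -> : mkseq (fun k => odd (v %/ 2 ^ (n.+1 - k.+1))) n =
    mkseq (fun k => odd (v./2 %/ 2 ^ (n - k.+1))) n.
  apply/eq_in_map => k; rewrite mem_iota => /= lt_k.
  by rewrite subSn // expnS divnMA divn2.
rewrite IH expnS; have := divn_eq v./2 (2 ^ n); have := odd_double_half v.
have := ltn_pmod v./2 (expn_gt0 2 n); set q := (_ %/ _)%N; set t := (_ %% _)%N.
move=> lt_t /esym vE hE; rewrite [in RHS]vE [in RHS]hE.
have -> : (odd v + (q * 2 ^ n + t).*2 = q * (2 * 2 ^ n) + (t.*2 + odd v))%N.
  by lia.
rewrite modnMDl modn_small //; case: (odd v); lia.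
Qed.

(** * Flipping a single bit *)

Section Flip.
Variables (n i : nat).
Hypothesis lt_i : (i < n)%N.

Definition flip (x : n.-tuple bool) : n.-tuple bool :=
  [tuple (val k == i) (+) tnth x k | k < n].

Lemma nth_flip x j : nth false (flip x) j = (j == i) (+) nth false x j.
Proof.
have [lt_j|le_j] := ltnP j n.
  have := tnth_mktuple (fun k : 'I_n => (val k == i) (+) tnth x k)
    (Ordinal lt_j).
  by rewrite !(tnth_nth false).
rewrite !nth_default ?size_tuple //; case: eqP => // E; lia.
Qed.

Lemma flipK : involutive flip.
Proof.
by move=> x; apply: eq_from_nth_tuple => j _; rewrite !nth_flip addKb.
Qed.

(** Terms are added on both sides because subtraction in [nat] truncates. Powers of two for [w] give
    the binary value, the constant 1 gives the weight. *)
Lemma sum_flip (w : nat -> nat) x :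
  (\sum_(k < n) nth false (flip x) k * w k + nth false x i * w i =
   \sum_(k < n) nth false x k * w k + ~~ nth false x i * w i)%N.
Proof.
rewrite (bigD1 (Ordinal lt_i)) // [in RHS](bigD1 (Ordinal lt_i)) //=.
rewrite nth_flip eqxx addTb.
rewrite (eq_bigr (fun k : 'I_n => nth false x k * w k)%N).
  by rewrite addnAC [in RHS]addnAC; congr (_ + _)%N; rewrite addnC.
move=> k ki; rewrite nth_flip -(inj_eq val_inj) /= in ki *.
by rewrite (negPf ki).
Qed.

Lemma bits_val_flip x :
  (bits_val (flip x) + nth false x i * 2 ^ (n - i.+1) =
   bits_val x + ~~ nth false x i * 2 ^ (n - i.+1))%N.
Proof.
by rewrite !bits_valE !size_tuple (sum_flip (fun k => 2 ^ (n - k.+1)))%N.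
Qed.

Lemma wt_flip x : (wt (flip x) + nth false x i = wt x + ~~ nth false x i)%N.
Proof.
have := sum_flip (fun=> 1)%N x; rewrite !muln1 !wtE !size_tuple.
by under eq_bigr do rewrite muln1;
  under [in X in _ = X]eq_bigr do rewrite muln1.
Qed.

End Flip.

(** * Addition with end-around carry *)

(** [c] is both the carry entering at the bottom and the one leaving at the top. Since [X] and [S]
    agree in bit [e], the carry into position [e.+1] is that common bit, whatever lies below. It
    differs from bit [e.+1] of [S], so together they add exactly 1 there and flip the bit of [X]. *)
Lemma odd_divn_sum n e X S Y (c : bool) : (e.+1 < n)%N ->
  (X + S + c = Y + c * 2 ^ n)%N ->
  odd (X %/ 2 ^ e) = odd (S %/ 2 ^ e) ->
  odd (S %/ 2 ^ e.+1) != odd (S %/ 2 ^ e) ->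
  odd (Y %/ 2 ^ e.+1) = ~~ odd (X %/ 2 ^ e.+1).
Proof.
move=> lt_e XSY XS SS.
have p_gt0 : (0 < 2 ^ e.+1)%N by rewrite expn_gt0.
have carry_lt (d : bool) a u u' : (u < a -> u' < a -> u + u' + d < a + a)%N.
  by clear; case: d; lia.
have half Z : (Z %/ 2 ^ e.+1 = (Z %/ 2 ^ e)./2)%N.
  by rewrite expnSr divnMA divn2.
have E1 : ((X + S + c) %/ 2 ^ e.+1 =
    X %/ 2 ^ e.+1 + S %/ 2 ^ e.+1 + odd (S %/ 2 ^ e))%N.
  have := divn_eq X (2 ^ e); have := divn_eq S (2 ^ e).
  have := ltn_pmod X (expn_gt0 2 e); have := ltn_pmod S (expn_gt0 2 e).
  have := odd_double_half (X %/ 2 ^ e); have := odd_double_half (S %/ 2 ^ e).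
  rewrite -!half XS; set b : nat := odd _.
  set q := (X %/ 2 ^ e.+1)%N; set q' := (S %/ 2 ^ e.+1)%N.
  set t := (X %% _)%N; set t' := (S %% _)%N.
  move=> <- <- lt_t' lt_t SE XE.
  have -> : (X + S + c = (q + q' + b) * 2 ^ e.+1 + (t + t' + c))%N.
    by rewrite [in LHS]SE [in LHS]XE expnSr; lia.
  rewrite divnMDl // divn_small ?addn0 // expnSr muln2 -addnn.
  exact: carry_lt.
have E2 : ((X + S + c) %/ 2 ^ e.+1 = Y %/ 2 ^ e.+1 + c * 2 ^ (n - e.+1))%N.
  have -> : (X + S + c = (c * 2 ^ (n - e.+1)) * 2 ^ e.+1 + Y)%N.
    by rewrite XSY -mulnA -expnD subnK ?(ltnW lt_e) // addnC.
  by rewrite divnMDl // addnC.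
have : odd (Y %/ 2 ^ e.+1 + c * 2 ^ (n - e.+1)) =
    odd (X %/ 2 ^ e.+1 + S %/ 2 ^ e.+1 + odd (S %/ 2 ^ e)) by rewrite -E1 -E2.
rewrite !oddD oddM oddX subn_eq0 leqNgt lt_e andbF addbF oddb => ->.
by move: SS; case: odd; case: odd; case: odd.
Qed.

Section EndAroundAdd.
Variables (n : nat) (sigma : n.-tuple bool).
Local Notation S := (bits_val sigma).

(* Both 0^n and 1^n represent the residue 0: fixing 0^n is what makes the map
   injective. *)
Definition end_around_add (x : n.-tuple bool) : n.-tuple bool :=
  if bits_val x == 0%N then x else
  let v := (bits_val x + S)%N in
  bits_of n (if v < 2 ^ n then v else v.+1 - 2 ^ n)%N.

Lemma bits_val_end_around_add (x : n.-tuple bool) : bits_val x != 0%N ->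
  bits_val (end_around_add x) =
  (if bits_val x + S < 2 ^ n then bits_val x + S
   else (bits_val x + S).+1 - 2 ^ n)%N.
Proof.
move=> x_neq0; rewrite /end_around_add (negPf x_neq0) bits_ofK //.
have := ltn_bits_val x; have := ltn_bits_val sigma; rewrite !size_tuple.
by case: ifP; lia.
Qed.

Lemma end_around_add_neq0 (x : n.-tuple bool) :
  bits_val x != 0%N -> bits_val (end_around_add x) != 0%N.
Proof.
by move=> x_neq0; rewrite bits_val_end_around_add //; case: ifP; lia.
Qed.

(** On strings of nonzero value the two branches have disjoint ranges: without wrap-around the
    result exceeds [S], with it the result is at most [S]. *)
Lemma end_around_add_inj : injective end_around_add.
Proof.
move=> x y; have [x0|x_neq0] := eqVneq (bits_val x) 0%N.
  have [y0|y_neq0] := eqVneq (bits_val y) 0%N.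
    by move=> _; apply: bits_val_inj; rewrite x0 y0.
  move=> E; have := end_around_add_neq0 y_neq0; rewrite -E.
  by rewrite /end_around_add x0 eqxx x0.
have [y0|y_neq0] := eqVneq (bits_val y) 0%N.
  move=> E; have := end_around_add_neq0 x_neq0; rewrite E.
  by rewrite /end_around_add y0 eqxx y0.
move=> /(congr1 (fun z : n.-tuple bool => bits_val z)).
rewrite !bits_val_end_around_add // => E; apply: bits_val_inj.
have := ltn_bits_val x; have := ltn_bits_val y; rewrite !size_tuple.
by move: E; case: ifP; case: ifP; lia.
Qed.

Lemma residue_end_around_add (x : n.-tuple bool) :
  (0 < n)%N -> bits_val x != 0%N ->
  residue (end_around_add x) = residue sigma + residue x.
Proof.
move=> n_gt0 x_neq0; apply: val_inj.
rewrite /= modnDm bits_val_end_around_add // [in RHS]addnC.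
have n2 : (2 <= 2 ^ n)%N by rewrite -{1}(expn1 2) leq_exp2l.
case: ifP => // /negbT; rewrite -leqNgt => le_n.
have E : (bits_val x + S = ((bits_val x + S).+1 - 2 ^ n) + (2 ^ n - 2).+1)%N.
  by lia.
by rewrite [in RHS]E modnDr.
Qed.

End EndAroundAdd.

(** * Exchanging adjacent bits at the changes of [sigma] *)

Section BitSwaps.
Variables (n : nat) (sigma : n.-tuple bool).
Implicit Types (x : n.-tuple bool) (i j : nat).
Local Notation bit x i := (nth false (tval x) i).

(** A change at position 0 is left out, as the exchange uses the bit at [i.-1]. *)
Definition change i :=
  [&& 0 < i, i.+1 < n & bit sigma i != bit sigma i.+1]%N.

Definition active i x :=
  (bit x i.+1 == bit sigma i.+1) && (bit x i.-1 != bit x i).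

(** Exchanging two different bits amounts to flipping both. *)
Definition swap i x := if active i x then flip i (flip i.-1 x) else x.

Lemma nth_swap i x j : change i ->
  bit (swap i x) j = (active i x && ((j == i) || (j == i.-1))) (+) bit x j.
Proof.
move=> /and3P[i_gt0 lt_i _]; rewrite /swap; case: (active i x) => //=.
by rewrite !nth_flip; lia.
Qed.

Lemma active_swap i x : change i -> active i (swap i x) = active i x.
Proof.
move=> ch; have /and3P[i_gt0 lt_i _] := ch; rewrite /active !nth_swap //.
have -> : i.+1 == i = false by lia.
have -> : i.+1 == i.-1 = false by lia.
rewrite !eqxx orbT /= andbF addFb andbT.
by case: (active i x); rewrite //= (inj_eq negb_inj).
Qed.

Lemma swapK i : change i -> involutive (swap i).
Proof.
move=> ch x; apply: eq_from_nth_tuple => j _.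
by rewrite !nth_swap // active_swap // addKb.
Qed.

Lemma active_swap_far i j x : change i -> change j ->
  (i + 2 < j)%N || (j + 2 < i)%N ->
  active j (swap i x) = active j x /\ bit (swap i x) j = bit x j.
Proof.
move=> chi chj far; have /and3P[i_gt0 lt_i _] := chi.
have /and3P[j_gt0 lt_j _] := chj.
have E k : (k == j.+1) || (k == j) || (k == j.-1) -> bit (swap i x) k = bit x k.
  move=> kj; rewrite nth_swap //.
  have -> : (k == i) || (k == i.-1) = false by lia.
  by rewrite andbF.
by rewrite /active !E ?eqxx ?orbT.
Qed.

Lemma wt_swap i x : change i -> wt (swap i x) = wt x.
Proof.
move=> /and3P[i_gt0 lt_i _]; rewrite /swap; case: ifP => // /andP[_ ne].
have lt1 : (i < n)%N by lia.
have lt2 : (i.-1 < n)%N by lia.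
have := wt_flip lt1 (flip i.-1 x); have := wt_flip lt2 x.
rewrite nth_flip // (_ : i == i.-1 = false); last by lia.
by move: ne; rewrite addFb; case: (bit x i); case: (bit x i.-1) => //=; lia.
Qed.

(** Position [i.-1] weighs twice as much as position [i], so the exchange moves the value by a
    single [2 ^ (n - i.+1)], upwards exactly when bit [i] is 1. *)
Lemma bits_val_swap i x : change i -> active i x ->
  (bits_val (swap i x) + ~~ bit x i * 2 ^ (n - i.+1) =
   bits_val x + bit x i * 2 ^ (n - i.+1))%N.
Proof.
move=> /and3P[i_gt0 lt_i _] act; rewrite /swap act; case/andP: act => _ ne.
have lt1 : (i < n)%N by lia.
have lt2 : (i.-1 < n)%N by lia.
have := bits_val_flip lt1 (flip i.-1 x); have := bits_val_flip lt2 x.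
rewrite nth_flip // (_ : i == i.-1 = false); last by lia.
rewrite (_ : n - i.-1.+1 = (n - i.+1).+1)%N; last by lia.
rewrite expnS; move: ne; rewrite addFb; move: (2 ^ _)%N => a.
by case: (bit x i); case: (bit x i.-1) => //=; lia.
Qed.

(* The carry into position [i] is [sigma_(i+1)] whatever the bits to its right
   are, and [sigma_i] is the other bit. *)
Lemma nth_sum_active i x (y : n.-tuple bool) (c : bool) :
  change i -> active i x ->
  (bits_val x + bits_val sigma + c = bits_val y + c * 2 ^ n)%N ->
  bit y i = ~~ bit x i.
Proof.
move=> /and3P[i_gt0 lt_i ch] /andP[/eqP xs _] E.
have lt1 : (i < n)%N by lia.
have e1 : (n - i.+1 = (n - i.+2).+1)%N by lia.
have lt_e : ((n - i.+2).+1 < n)%N by lia.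
move: ch xs; rewrite !nth_bits_val ?size_tuple // !e1 => ch xs.
exact: odd_divn_sum lt_e E xs ch.
Qed.

Local Notation T := (end_around_add sigma).

Lemma active_neq0 i x : change i -> active i x -> bits_val x != 0%N.
Proof.
move=> /and3P[i_gt0 lt_i _] /andP[_]; apply: contraNneq => x0.
have lt1 : (i < n)%N by lia.
have lt2 : (i.-1 < n)%N by lia.
by rewrite !nth_bits_val ?size_tuple // x0 !div0n.
Qed.

Lemma nth_end_around_add i x : change i -> active i x ->
  bit (T x) i = ~~ bit x i.
Proof.
move=> ch act; have x0 := active_neq0 ch act.
apply: (nth_sum_active (c := ~~ (bits_val x + bits_val sigma < 2 ^ n)%N)) => //.
rewrite bits_val_end_around_add //.
by case: ltnP => /= ?; lia.
Qed.

(** By [nth_end_around_add], flipping bit [i] of [T x] moves its value by the same signed power of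
    two as the exchange moves that of [x]. It remains to see that the exchange does not alter
    whether the addition wraps around. *)
Lemma end_around_add_swap i x : change i -> active i x ->
  T (swap i x) = flip i (T x).
Proof.
move=> ch act; have x0 := active_neq0 ch act.
have act' : active i (swap i x) by rewrite active_swap.
have x'0 := active_neq0 ch act'.
have /and3P[i_gt0 lt_i _] := ch.
have lt1 : (i < n)%N by lia.
have fE := bits_val_flip lt1 (T x).
rewrite nth_end_around_add // negbK in fE.
have sE := bits_val_swap ch act.
(* A sum equal to [2 ^ n - 1] could be read as 1^n with carry 0 or as 0^n with carry 1, and
   [nth_sum_active] would give bit [i] both values. *)
have not_full : (bits_val (swap i x) + bits_val sigma + 1 != 2 ^ n)%N.
  apply/eqP => E; have p_gt0 := expn_gt0 2 n.
  have H1 := nth_sum_active (y := nseq_tuple n true) (c := false) ch act'.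
  have H0 := nth_sum_active (y := bits_of n 0) (c := true) ch act'.
  have b0 : bit (bits_of n 0) i = false.
    by rewrite nth_bits_val ?size_tuple // bits_ofK // div0n.
  rewrite b0 bits_ofK // E mul1n add0n in H0.
  rewrite -(H0 erefl) nth_nseq lt1 in H1.
  suff: true = false by [].
  by apply: H1; have := bits_val_nseq_true n; move: E => /=; lia.
apply: bits_val_inj => /=; move: fE; rewrite !bits_val_end_around_add //.
have := ltn_bits_val (flip i (T x)); rewrite size_tuple.
move: sE not_full; move: (bits_val (flip i (T x))) (bits_val (swap i x)) => z y.
move: (bits_val x) (bits_val sigma) (2 ^ (n - i.+1))%N (2 ^ n)%N => u S a N.
by case: (bit x i) => /=; case: (ltnP (u + S) N); case: (ltnP (y + S) N); lia.
Qed.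

Lemma wt_end_around_add_swap i x : change i -> active i x ->
  (wt (T (swap i x)) + ~~ bit x i = wt (T x) + bit x i)%N.
Proof.
move=> ch act; have /and3P[i_gt0 lt_i _] := ch.
have lt1 : (i < n)%N by lia.
have := wt_flip lt1 (T x).
by rewrite -end_around_add_swap // nth_end_around_add // negbK.
Qed.

(** * Signs of the exchanges and their correlations *)

Section Signs.
Variable R : realFieldType.

Definition swap_sign i x : R := if active i x then (-1) ^+ bit x i else 0.

Lemma swap_sign_anti i x : change i -> swap_sign i (swap i x) = - swap_sign i x.
Proof.
move=> ch; rewrite /swap_sign active_swap // nth_swap // eqxx /=.
case: (active i x); last by rewrite oppr0.
by case: (bit x i); rewrite /= ?opprK.
Qed.

Lemma swap_sign_far i j x : change i -> change j ->
  (i + 2 < j)%N || (j + 2 < i)%N -> swap_sign j (swap i x) = swap_sign j x.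
Proof.
move=> chi chj far; rewrite /swap_sign.
by have [-> ->] := active_swap_far x chi chj far.
Qed.

Lemma swap_sign_sqr i x : swap_sign i x ^+ 2 = (active i x)%:R.
Proof.
rewrite /swap_sign; case: (active i x); last by rewrite expr0n.
by rewrite sqrr_sign.
Qed.

Lemma swap_sign_le1 i x : `|swap_sign i x| <= 1.
Proof.
rewrite /swap_sign; case: (active i x); last by rewrite normr0 ler01.
by rewrite normr_sign.
Qed.

Lemma wt_swap_sign i x : change i ->
  (wt (T (swap i x)))%:R = (wt (T x))%:R - swap_sign i x :> R.
Proof.
move=> ch; rewrite /swap_sign; case: ifP => [act|nact]; last first.
  by rewrite /swap nact subr0.
have := congr1 (fun m => m%:R : R) (wt_end_around_add_swap ch act).
rewrite !natrD; case: (bit x i) => /=; lra.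
Qed.

(** Flipping bits [i.+1] and [i.-1] independently preserves [F] and yields four strings, exactly one
    of them active at [i]. *)
Lemma sum_active_centered i (F : n.-tuple bool -> R) : change i ->
  (forall x, F (flip i.+1 x) = F x) -> (forall x, F (flip i.-1 x) = F x) ->
  \sum_x ((active i x)%:R - 4^-1) * F x = 0.
Proof.
move=> ch FS FP; have /and3P[i_gt0 lt_i _] := ch.
have lt1 : (i.-1 < n)%N by lia.
have KS := flipK lt_i; have KP := flipK lt1.
pose A x := ((active i x)%:R - 4^-1) * F x.
have E1 : \sum_x A (flip i.+1 x) = \sum_x A x by apply: sum_involutive.
have E2 : \sum_x A (flip i.-1 x) = \sum_x A x by apply: sum_involutive.
have E3 : \sum_x A (flip i.+1 (flip i.-1 x)) = \sum_x A x.
  by rewrite -E1; apply: (sum_involutive (fun x => A (flip i.+1 x))).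
have : \sum_x (A x + A (flip i.+1 x) + A (flip i.-1 x) +
    A (flip i.+1 (flip i.-1 x))) = 0.
  rewrite big1 // => x _; rewrite /A !FS !FP -!mulrDl.
  rewrite [X in X * _](_ : _ = 0) ?mul0r // /active !nth_flip //.
  rewrite !eqxx.
  have -> : i == i.+1 = false by lia.
  have -> : i == i.-1 = false by lia.
  have -> : i.-1 == i.+1 = false by lia.
  have -> : i.+1 == i.-1 = false by lia.
  rewrite !addTb !addFb.
  by case: (bit x i.+1); case: (bit sigma i.+1); case: (bit x i.-1);
    case: (bit x i) => /=; field.
rewrite !big_split /= E1 E2 E3 /A; lra.
Qed.

Lemma active_flip_far i j k x : change i -> change j -> (k < n)%N ->
  (i + 2 < j)%N || (j + 2 < i)%N -> (k == i.+1) || (k == i.-1) ->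
  active j (flip k x) = active j x.
Proof.
move=> chi chj lt_k far ki; have /and3P[i_gt0 lt_i _] := chi.
have /and3P[j_gt0 lt_j _] := chj.
rewrite /active !nth_flip //.
have -> : j == k = false by lia.
have -> : j.-1 == k = false by lia.
by have -> : j.+1 == k = false by lia.
Qed.

Lemma sum_active_orth i j : change i -> change j ->
  (i + 2 < j)%N || (j + 2 < i)%N ->
  \sum_x (swap_sign i x ^+ 2 - 4^-1) * (swap_sign j x ^+ 2 - 4^-1) = 0.
Proof.
move=> chi chj far; under eq_bigr do rewrite !swap_sign_sqr.
have /and3P[i_gt0 lt_i _] := chi.
have lt1 : (i.-1 < n)%N by lia.
by apply: sum_active_centered => // x;
  rewrite (active_flip_far _ chi) ?eqxx ?orbT.
Qed.

End Signs.
End BitSwaps.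

(** * Distribution of the weight of a uniform string *)

Section Weights.
Variables (R : realFieldType) (n : nat).

(** Centred bits have square 1/4 and are pairwise orthogonal, since flipping one bit negates its
    centred value and preserves the others. *)
Lemma sum_wt_deviation_sqr :
  \sum_(x : n.-tuple bool) ((wt x)%:R - n%:R / 2) ^+ 2 =
  n%:R / 4 * #|{: n.-tuple bool}|%:R :> R.
Proof.
pose f (k : 'I_n) (x : n.-tuple bool) : R := (nth false x k)%:R - 2^-1.
transitivity (\sum_(x : n.-tuple bool) 1 * (\sum_(k <- enum 'I_n) f k x) ^+ 2).
  apply: eq_bigr => x _; rewrite mul1r; congr (_ ^+ 2).
  rewrite big_enum /= sumrB sumr_const card_ord -natr_sum wtE size_tuple.
  by rewrite -[2^-1 *+ n]mulr_natl.
rewrite sum_weighted_sqr_orthogonal ?enum_uniq //.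
  have f2 k x : 1 * f k x ^+ 2 = 4^-1.
    by rewrite /f; case: (nth false x k) => /=; field.
  under eq_bigr do under eq_bigr do rewrite f2.
  rewrite big_enum /= !sumr_const card_ord -[_ *+ _ *+ _]mulr_natr.
  rewrite -[4^-1 *+ _]mulr_natr; ring.
move=> k l _ _ kl; apply: (sum_odd_involutive (flipK (ltn_ord k))) => x.
rewrite /f !nth_flip ?ltn_ord // eqxx (inj_eq val_inj) eq_sym (negPf kl) addFb.
by case: (nth false x k) => /=; field.
Qed.

(** Bitwise complement sends heavy strings to light ones. *)
Lemma leq_heavy_light :
  (#|[pred x : n.-tuple bool | n < (wt x).*2]| <= #|light n|)%N.
Proof.
pose neg (x : n.-tuple bool) := map_tuple negb x.
have negI : injective neg.
  by move=> x y /(congr1 val) /= /(inj_map negb_inj) /val_inj.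
rewrite -(card_image negI); apply/subset_leq_card/subsetP => _ /imageP[x hx ->].
move: hx; rewrite !inE /= /wt count_map => hx.
have := count_predC id x; rewrite size_tuple.
have -> : count (preim negb id) x = count (predC id) x by apply: eq_count.
by move: hx; move: (count id x) (count (predC id) x) => a b; lia.
Qed.

Lemma light_heavy_card :
  (#|light n| + #|[pred x : n.-tuple bool | n < (wt x).*2]| = 2 ^ n)%N.
Proof.
rewrite -[RHS](_ : #|{: n.-tuple bool}| = _)%N; last first.
  by rewrite card_tuple card_bool.
rewrite -(cardC (mem (light n))); congr (_ + _)%N.
by apply: eq_card => x; rewrite !inE /= ltnNge.
Qed.

End Weights.

(** * From runs to well-separated changes *)

Definition num_changes (s : seq bool) : nat :=
  \sum_(i < (size s).-1) (nth false s i != nth false s i.+1).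

Lemma num_changes_cons b a s :
  num_changes [:: b, a & s] = ((b != a) + num_changes (a :: s))%N.
Proof. by rewrite /num_changes /= big_ord_recl. Qed.

Lemma num_changes_nseq L b a s : (0 < L)%N ->
  ((b != a) + num_changes (a :: s) <= num_changes (nseq L b ++ a :: s))%N.
Proof.
case: L => // L _; elim: L => [|L IH]; first by rewrite num_changes_cons.
by apply: leq_trans IH _; rewrite /= num_changes_cons leq_addl.
Qed.

Lemma size_maximal_runs s r :
  maximal_runs s r -> (size r <= (num_changes s).+1)%N.
Proof.
case=> -> ; elim: r {s} => // -[b L] [|[a K] r] // IH.
move=> /= /and3P[L_gt0 K_gt0 r_gt0] /andP[ba r_sorted].
have {}IH := IH _ _; rewrite /= K_gt0 r_gt0 in IH.
have {}IH := IH isT r_sorted.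
case: K K_gt0 r_sorted IH => // K _ _ IH; rewrite ltnS; apply: leq_trans IH _.
have := num_changes_nseq b a
  (nseq K a ++ flatten [seq nseq p.2 p.1 | p <- r]) L_gt0.
by rewrite /= ba add1n.
Qed.

Definition change_positions n (sigma : n.-tuple bool) (a : nat) : seq nat :=
  [seq i <- iota 0 n | change sigma i && (i %% 3 == a)%N].

Lemma size_change_positions n (sigma : n.-tuple bool) a :
  (size (change_positions sigma a) <= n)%N.
Proof. by rewrite size_filter (leq_trans (count_size _ _)) ?size_iota. Qed.

Lemma change_positions_far n (sigma : n.-tuple bool) a :
  {in change_positions sigma a &, forall i j, i != j ->
    (i + 2 < j)%N || (j + 2 < i)%N}.
Proof.
move=> i j; rewrite !mem_filter => /andP[/andP[_ /eqP ia] _].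
by move=> /andP[/andP[_ /eqP ja] _]; lia.
Qed.

(** The 2 pays for having one boundary fewer than runs and for a possible change at position 0,
    which [change] excludes; the 3 is the pigeonhole principle over residue classes. *)
Lemma exists_change_positions n (sigma : n.-tuple bool) r :
  maximal_runs sigma r ->
  exists a, (size r <= 3 * size (change_positions sigma a) + 2)%N.
Proof.
move=> /size_maximal_runs le_r.
have le_c : (num_changes sigma <= (count (change sigma) (iota 0 n)).+1)%N.
  have -> : iota 0 n = index_iota 0 n by rewrite /index_iota subn0.
  rewrite -sum1_count.
  rewrite big_mkcond /= big_mkord /num_changes size_tuple.
  case: n sigma {le_r} => [|n] sigma; first by rewrite /= !big_ord0.
  rewrite big_ord_recr /= -addSn; apply: leq_trans (leq_addr _ _).
  case: n sigma => [|n] sigma; first by rewrite /= !big_ord0.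
  rewrite !big_ord_recl /= add0n -[leqRHS]add1n.
  apply: leq_add; first by case: (_ != _).
  apply: leq_sum => i _.
  rewrite /change /bump /=; case: (_ != _) => //=.
  by have := ltn_ord i; case: ifP => //; lia.
have split3 : count (change sigma) (iota 0 n) =
    (size (change_positions sigma 0) + size (change_positions sigma 1) +
     size (change_positions sigma 2))%N.
  rewrite !size_filter; elim: (iota 0 n) => //= i s ->.
  have : (i %% 3 < 3)%N by rewrite ltn_mod.
  by case: (i %% 3)%N => [|[|[|]]] //= _; rewrite ?andbT ?andbF; lia.
have [H|H] := leqP (size r) (3 * size (change_positions sigma 0) + 2).
  by exists 0%N.
have [H'|H'] := leqP (size r) (3 * size (change_positions sigma 1) + 2).
  by exists 1%N.
by exists 2%N; lia.
Qed.

(** * Lower bounds for the union *)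

(** The images of the counted strings are distinct, heavy, and in the shift. The string 0^n, where
    the map does not add [sigma], is not counted: it is fixed and light. *)
Lemma card_union_shift_ge n (sigma : n.-tuple bool) : (0 < n)%N ->
  (#|light n| + #|[pred x : n.-tuple bool | ~~ (n < (wt x).*2) &
       (n < (wt (end_around_add sigma x)).*2)]| <=
   #|light n :|: shift (residue sigma) (light n)|)%N.
Proof.
move=> n_gt0; set B := [pred x | _].
rewrite -(cardsE B) -(card_imset _ (@end_around_add_inj n sigma)) -cardsUI.
rewrite [_ :&: _](_ : _ = set0) ?cards0 ?addn0.
  apply/subset_leq_card/setUS/subsetP => _ /imsetP[x + ->].
  rewrite !inE /= -leqNgt => /andP[x_light Tx_heavy].
  have x0 : bits_val x != 0%N.
    apply/eqP => x0; move: Tx_heavy; rewrite /end_around_add x0 eqxx.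
    by rewrite ltnNge x_light.
  apply/imsetP; exists x; first by rewrite inE.
  by rewrite residue_end_around_add.
apply/setP => y; rewrite in_setI !inE; apply/negbTE/negP => /andP[y_light].
move=> /imsetP[x /[!inE] /andP[_ x_heavy] yE].
by move: x_heavy; rewrite -yE ltnNge y_light.
Qed.

(** Used for small [n]. If the shift added nothing, the residues of light strings would be stable
    under adding [alpha], with equality by cardinality. As 0 is among them, 1^n, which also
    represents 0, would be light. *)
Lemma ltn_light_union n (alpha : Zmers n) : (0 < n)%N ->
  (#|light n| < #|light n :|: shift alpha (light n)|)%N.
Proof.
move=> n_gt0; apply/proper_card; rewrite properEneq subsetUl andbT.
apply/eqP => /esym/setUidPl sub.
have n2 : (2 <= 2 ^ n)%N by rewrite -{1}(expn1 2) leq_exp2l.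
pose L := [set residue x | x in light n].
have sL : [set alpha + residue x | x in light n] \subset L.
  apply/subsetP => _ /imsetP[x xl ->].
  pose y := bits_of n (val (alpha + residue x)).
  have yE : residue y = alpha + residue x.
    have lt_v := ltn_ord (alpha + residue x).
    have lt_y : (val (alpha + residue x)%R < 2 ^ n)%N.
      by apply: leq_trans lt_v _; lia.
    apply: val_inj; rewrite [LHS]/= /y bits_ofK // modn_small //.
  apply/imsetP; exists y => //; apply: (subsetP sub).
  by rewrite inE yE; apply/imsetP; exists x.
have EL : [set alpha + residue x | x in light n] = L.
  apply/eqP; rewrite eqEcard sL /=.
  have -> : [set alpha + residue x | x in light n] = +%R alpha @: L.
    by rewrite /L -imset_comp.
  by rewrite (card_imset _ (addrI alpha)).
have zero_light : nseq_tuple n false \in light n.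
  by rewrite inE /= /wt count_nseq.
have res0 : residue (nseq_tuple n true) = residue (nseq_tuple n false).
  apply: val_inj => /=; have := bits_val_nseq_true n.
  have -> : bits_val (nseq n false) = 0%N.
    by elim: (n) => // k IH; rewrite -(addn1 k) nseqD cats1 bits_val_rcons IH.
  move=> E; have -> : bits_val (nseq n true) = (2 ^ n - 2).+1 by lia.
  by rewrite modnn mod0n.
suff : nseq_tuple n true \in light n.
  by rewrite inE /= /wt count_nseq; lia.
apply: (subsetP sub); rewrite inE EL res0.
by apply/imsetP; exists (nseq_tuple n false).
Qed.

(** * Bounds on powers of [1 + t] *)

Lemma expr1D_le_linear (R : realFieldType) (t : R) k :
  0 <= t -> 2 * (t * k%:R) <= 1 -> (1 + t) ^+ k <= 1 + 2 * (t * k%:R).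
Proof.
move=> t_ge0; elim: k => [|k IH]; first by rewrite mulr0 mulr0 addr0.
rewrite -natr1 => tk; have k_ge0 : 0 <= t * k%:R by rewrite mulr_ge0.
have {}IH := IH ltac:(lra); rewrite exprSr.
apply: le_trans (ler_wpM2r _ IH) _; first lra.
have : 0 <= t * (1 - 2 * (t * k%:R)) by rewrite mulr_ge0 //; lra.
lra.
Qed.

Lemma bernoulli (R : realFieldType) (t : R) k :
  0 <= t -> 1 + k%:R * t <= (1 + t) ^+ k.
Proof.
move=> t_ge0; elim: k => [|k IH]; first by rewrite mul0r addr0.
rewrite -natr1 exprSr; apply: le_trans (ler_wpM2r _ IH); last lra.
have : 0 <= k%:R * t * t by rewrite !mulr_ge0.
lra.
Qed.

(** Bernoulli gives [1 + t <= (1 + t / K%:R) ^+ K], and the [k]-th power of the inner base is at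
    most 2. *)
Lemma expr1D_le_pow2 (R : realFieldType) (t : R) k K :
  0 <= t -> (0 < K)%N -> 2 * (t * k%:R) <= K%:R -> (1 + t) ^+ k <= 2 ^+ K.
Proof.
move=> t_ge0 K_gt0 tk; have K_gt0R : 0 < K%:R :> R by rewrite ltr0n.
have tK_ge0 : 0 <= t / K%:R by rewrite divr_ge0.
apply: le_trans (_ : ((1 + t / K%:R) ^+ k) ^+ K <= _).
  rewrite exprAC lerXn2r ?nnegrE ?exprn_ge0 ?addr_ge0 //.
  by have := bernoulli K tK_ge0; rewrite mulrCA divff ?mulr1 ?gt_eqF.
rewrite lerXn2r ?nnegrE ?exprn_ge0 ?addr_ge0 //.
have le1 : 2 * (t / K%:R * k%:R) <= 1.
  by rewrite mulrAC mulrA ler_pdivrMr // mul1r.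
by apply: le_trans (expr1D_le_linear tK_ge0 le1) _; lra.
Qed.

(** * Choice of parameters and conclusion *)

Lemma card_light_to_heavy_ge (R : realType) n (sigma : n.-tuple bool) a
    (A c : R) K :
  0 < c -> 24 <= A * c -> A ^+ 2 <= n%:R -> (0 < n)%N ->
  2 * A ^+ 2 <= K%:R ->
  c * n%:R <= (size (change_positions sigma a))%:R ->
  2 ^+ n <= 16 * 2 ^+ K *
    #|[pred x : n.-tuple bool | ~~ (n < (wt x).*2)%N &
       (n < (wt (end_around_add sigma x)).*2)%N]|%:R :> R.
Proof.
move=> c_gt0 Ac An n_gt0 AK; set q := change_positions sigma a => le_q.
have nR_gt0 : 0 < n%:R :> R by rewrite ltr0n.
have A_gt0 : 0 < A.
  by rewrite -(pmulr_lgt0 _ c_gt0) (lt_le_trans _ Ac).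
have sq_gt0 : 0 < Num.sqrt (n%:R : R) by rewrite sqrtr_gt0.
have sqE : Num.sqrt (n%:R : R) ^+ 2 = n%:R by rewrite sqr_sqrtr ?ltW.
pose theta : R := A / Num.sqrt n%:R.
have theta2 : theta ^+ 2 = A ^+ 2 / n%:R by rewrite /theta expr_div_n sqE.
have theta_gt0 : 0 < theta by rewrite divr_gt0.
have theta_le1 : theta <= 1.
  have : theta ^+ 2 <= 1 by rewrite theta2 ler_pdivrMr ?mul1r.
  by rewrite expr_le1 // ltW.
have q_ch i : i \in q -> change sigma i.
  by rewrite mem_filter => /andP[/andP[]].
have far := @change_positions_far n sigma a.
have q_uniq : uniq q by rewrite filter_uniq ?iota_uniq.
have q_le : (size q)%:R <= n%:R :> R by rewrite ler_nat size_change_positions.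
have q_gt0 : 0 < (size q)%:R :> R by apply: lt_le_trans le_q; rewrite mulr_gt0.
have := @card_light_positive_ge R {: n.-tuple bool} nat q (swap sigma)
  (swap_sign sigma R) q_uniq _ _ _ theta _ (ltW theta_gt0) theta_le1 _
  (fun x => (wt (end_around_add sigma x))%:R - n%:R / 2) (n%:R / 4) _ _
  [pred x : n.-tuple bool | (n < (wt x).*2)%N] _ _ _ _.
rewrite card_tuple card_bool natrX => key.
apply: le_trans (key _ _ _ _ _ _ _ _ _ _ _) _.
- by move=> i iq; apply/swapK/q_ch.
- by move=> i iq x; rewrite swap_sign_anti ?q_ch.
- by move=> i j iq jq x ji; rewrite swap_sign_far ?q_ch ?far // eq_sym.
- by move=> i _ x; apply: swap_sign_le1.
- by move=> i j iq jq ij; rewrite sum_active_orth ?q_ch ?far.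
- by move=> i iq x; rewrite wt_swap_sign ?q_ch // addrAC.
(* Addition permutes the strings, so the sum has the same second moment as [x]. *)
- have := sum_wt_deviation_sqr R n.
  rewrite (reindex_inj (@end_around_add_inj n sigma)) /= => ->.
  by rewrite card_tuple card_bool natrX.
- by move=> i iq x; rewrite /= wt_swap ?q_ch.
- rewrite -natrM -natrX ler_nat -light_heavy_card mul2n -addnn leq_add2r.
  exact: leq_heavy_light.
(* Source of the 24: the squared drift is at least 24^2 n / 64 = 9n, while the required bound is at
   most 4 (n / 2 + n) = 6n. *)
- have -> : (theta * (size q)%:R / 8) ^+ 2 = theta ^+ 2 * (size q)%:R ^+ 2 / 64.
    by field.
  rewrite theta2.
  have : (c * n%:R) ^+ 2 <= (size q)%:R ^+ 2 :> R.
    by apply: lerXn2r le_q; rewrite nnegrE ?ler0n // mulr_ge0 // ltW.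
  rewrite exprMn => cq.
  have E : A ^+ 2 / n%:R * (c ^+ 2 * n%:R ^+ 2) = (A * c) ^+ 2 * n%:R :> R.
    by field; rewrite gt_eqF.
  have : A ^+ 2 / n%:R * (c ^+ 2 * n%:R ^+ 2) <=
      A ^+ 2 / n%:R * (size q)%:R ^+ 2.
    by rewrite ler_wpM2l ?divr_ge0 ?sqr_ge0.
  have : 24 ^+ 2 <= (A * c) ^+ 2.
    by apply: lerXn2r Ac; rewrite nnegrE // mulr_ge0 // ltW.
  move=> /(ler_wpM2r (ltW nR_gt0)).
  rewrite E; move: q_le; lra.
- by rewrite mulr_gt0.
- have K_gt0 : (0 < K)%N.
    by rewrite -(ltr0n R) (lt_le_trans _ AK) // mulr_gt0 ?exprn_gt0.
  have le_K : (1 + theta ^+ 2) ^+ size q <= 2 ^+ K.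
    apply: expr1D_le_pow2; rewrite ?sqr_ge0 //; apply: le_trans AK.
    rewrite ler_wpM2l // theta2 -mulrA ler_piMr ?sqr_ge0 //.
    by rewrite mulrC ler_pdivrMr ?mul1r.
  rewrite (eq_card (B := [pred x : n.-tuple bool | ~~ (n < (wt x).*2)%N &
       (n < (wt (end_around_add sigma x)).*2)%N])).
    by rewrite ler_wpM2r // ler_wpM2l.
  move=> x; rewrite !inE /=; congr (_ && _); rewrite -(ltr_nat R) -muln2 natrM.
  by apply/idP/idP; lra.
Qed.

Theorem theorem1 (R : realType) (c : R) (hc : 0 < c) :
  exists eps : R, 0 < eps /\
    forall (n : nat) (sigma : n.-tuple bool) (r : seq (bool * nat))
           (alpha : Zmers n),
      (1 <= n)%N ->
      maximal_runs sigma r ->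
      c * n%:R <= (size r)%:R ->
      alpha = residue sigma ->
      shifting_property eps alpha.
Proof.
(* The change positions will have density at least [c / 6], and [A * (c / 6) = 24]. *)
pose A : R := 144 / c; pose K := Num.bound (2 * A ^+ 2).
(* From [n0] on, [A ^+ 2 <= n%:R] keeps the tilt parameter at most 1, and [4 <= c * n%:R] absorbs
   the 2 lost in counting changes. *)
pose n0 := Num.bound (A ^+ 2 + 4 / c).
have A2_ge0 : 0 <= A ^+ 2 := sqr_ge0 A.
have c4_gt0 : 0 < 4 / c by rewrite divr_gt0.
have AK : 2 * A ^+ 2 <= K%:R by rewrite ltW // archi_boundP // mulr_ge0.
have n0_gt : A ^+ 2 + 4 / c < n0%:R by rewrite archi_boundP // addr_ge0 // ltW.
pose e1 : R := (16 * 2 ^+ K)^-1; pose e2 : R := (2 ^+ n0)^-1.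
have e1_gt0 : 0 < e1 by rewrite invr_gt0 mulr_gt0 // exprn_gt0.
have e2_gt0 : 0 < e2 by rewrite invr_gt0 exprn_gt0.
exists (Num.min e1 e2); split; first by rewrite lt_min e1_gt0.
move=> n sigma r alpha n_gt0 runs le_r ->; rewrite /shifting_property.
have half_light : 2^-1 * 2 ^+ n <= #|light n|%:R :> R.
  have : (2 ^ n)%:R <= (#|light n| * 2)%:R :> R.
    rewrite ler_nat -(light_heavy_card n) muln2 -addnn leq_add2l.
    exact: leq_heavy_light.
  by rewrite natrX natrM; lra.
have p_gt0 : 0 < 2 ^+ n :> R by rewrite exprn_gt0.
(* Below [n0] a single extra string suffices, since [e2 * 2 ^+ n <= 1]. *)
have [lt_n|le_n] := ltnP n n0.
  apply: le_trans (_ : (#|light n|.+1)%:R <= _); last first.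
    by rewrite ler_nat ltn_light_union.
  have : Num.min e1 e2 * 2 ^+ n <= 1.
    apply: le_trans (_ : e2 * 2 ^+ n <= _).
      by apply: ler_wpM2r; [rewrite ltW | rewrite ge_min lexx orbT].
    rewrite mulrC ler_pdivrMr ?exprn_gt0 // mul1r.
    by rewrite ler_eXn2l ?ltr1n // ltnW.
  by rewrite -(natr1 #|light n|) mulrDl => ?; apply: lerD.
have nR : A ^+ 2 + 4 / c <= n%:R by rewrite (le_trans (ltW n0_gt)) // ler_nat.
have [a le_a] := exists_change_positions runs.
have le_q : c / 6 * n%:R <= (size (change_positions sigma a))%:R.
  have : (size r)%:R <= (3 * size (change_positions sigma a) + 2)%:R :> R.
    by rewrite ler_nat.
  have : 4 <= c * n%:R.
    by rewrite mulrC -ler_pdivrMr //; lra.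
  by rewrite natrD natrM; lra.
have c6_gt0 : 0 < c / 6 by rewrite divr_gt0.
have Ac : 24 <= A * (c / 6).
  by rewrite (_ : A * (c / 6) = 24) //; rewrite /A; field; rewrite gt_eqF.
have An : A ^+ 2 <= n%:R by move: c4_gt0; lra.
have := card_light_to_heavy_ge c6_gt0 Ac An n_gt0 AK le_q.
have := card_union_shift_ge sigma n_gt0.
set B := #|[pred x | _]|; rewrite -(ler_nat R) natrD => le_union le_B.
apply: le_trans le_union; rewrite mulrDl lerD //.
apply: le_trans (_ : e1 * 2 ^+ n <= _).
  by apply: ler_wpM2r; [rewrite ltW | rewrite ge_min lexx].
by rewrite /e1 mulrC ler_pdivrMr ?mulr_gt0 ?exprn_gt0 // mulrC.
Qed.
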